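(* Let $E_{alt}=(0,1,0,1,0,1,0,\dots)\in\{0,1\}^{\mathbb{N}}$. Then \[\Phi(E_{alt})=\hat{\Phi}(E_{alt})=\Phi^*(E_{alt})=\operatorname{clos}(\mathbb{D})\cup\mathcal{G}_{[-1,1]}^{-1}.\]
   Context: $\mathbb{N}$ is the set of non-negative integers. Throughout, $\beta>1$ is a non-integer real number. For $y\in\mathbb{R}$, $[y]$ and $\{y\}$ denote the integer and fractional parts. $\mathbb{D}$ is the open unit disk in $\mathbb{C}$; $\operatorname{clos}(A)$ is the closure of $A\subset\mathbb{C}$ in $\mathbb{C}$; $A^{-1}=\{z^{-1}: z\in A\}$. Generalized beta-maps: for $E=(E(0),E(1),\dots)\in\{0,1\}^{\mathbb{N}}$, let $T_\beta(x)=\{\beta x\}$, $I_\beta(x)=[\beta x]$ and \[\tau_{\beta,E}:[0,1]\to[0,1],\qquad \tau_{\beta,E}(x)=E(I_\beta(x))+(-1)^{E(I_\beta(x))}T_\beta(x).\] For $E=E_{alt}$ (i.e. $E(i)=0$ for even $i$ and $E(i)=1$ for odd $i$) this is the continuous piecewise linear map obtained from $T_\beta$ by changing the odd-numbered branches (the left-most being the $0$-th) to negative ones. For $x\in[0,1]$ and $n\ge 0$ put \[d_n(\beta,E,x)=E(I_\beta(\tau_{\beta,E}^n(x)))+I_\beta(\tau_{\beta,E}^n(x)),\quad e_n(\beta,E,x)=(-1)^{E(I_\beta(\tau_{\beta,E}^n(x)))},\] $s_0(\beta,E,x)=1$ and $s_n(\beta,E,x)=\prod_{i=0}^{n-1}e_i(\beta,E,x)$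 for $n\ge1$. Let $EP=\{1/\beta,2/\beta,\dots,[\beta]/\beta\}$. $\beta$ is a generalized Parry number with respect to $E$ if the orbit $\{\tau_{\beta,E}^n(1): n\ge 0\}$ is a finite set; $\beta$ is simple with respect to $E$ if $\tau_{\beta,E}^n(1)\in EP$ for some $n\ge1$ (a simple $\beta$ is a generalized Parry number). Generalized Parry numbers are algebraic integers. A Galois conjugate of $\beta$ means a root in $\mathbb{C}$, different from $\beta$ itself, of the minimal polynomial of $\beta$ over $\mathbb{Q}$. $\Phi(E)$ is the closure of the set of all Galois conjugates of all simple generalized Parry numbers with respect to $E$; $\hat\Phi(E)$ is the closure of the set of all Galois conjugates of all generalized Parry numbers with respect to $E$. Define $\phi_{\tau_{\beta,E}}$ as follows. If $\beta$ is simple with respect to $E$, let $N=\min\{n\ge1:\tau_{\beta,E}^n(1)\in EP\}$, $k_0=\beta\tau_{\beta,E}^N(1)$ and \[\phi_{\tau_{\beta,E}}(z)=\sum_{n=0}^{N-1}s_n(\beta,E,1)d_n(\beta,E,1)z^{n+1}+k_0s_N(\beta,E,1)z^{N+1};\] otherwise \[\phi_{\tau_{\beta,E}}(z)=\sum_{n=0}^{\infty}s_n(\beta,E,1)d_n(\beta,E,1)z^{n+1}.\] This is a polynomial if $\beta$ is simple; it extends to a rational function on $\mathbb{C}$ if $\beta$ is a non-simple generalized Parry number; otherwise it is a power series considered on $\mathbb{D}$. One has $1-\phi_{\tau_{\beta,E}}(\beta^{-1})=0$. Set \[\Phi^*(E)=\operatorname{clos}\bigl(\{z^{-1}\in\mathbb{C}: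 \exists\,\beta>1 \text{ with } 1-\phi_{\tau_{\beta,E}}(z)=0,\ z\neq\beta^{-1}\}\bigr),\] where $z$ ranges over the domain of $\phi_{\tau_{\beta,E}}$ just described. For a bounded interval $I\subset\mathbb{R}$, let \[\mathcal{F}_I=\Bigl\{1+\sum_{n=1}^\infty a_nz^n: a_i\in I\text{ for } i\ge1\Bigr\},\qquad \mathcal{G}_I=\{z\in\mathbb{D}: \exists f\in\mathcal{F}_I \text{ with } f(z)=0\}.\] *)

(* Defs.v *)
From HB Require Import structures.
From mathcomp Require Import all_boot all_order all_algebra.
From mathcomp Require Import all_classical all_reals all_analysis complex.

Set Implicit Arguments.
Unset Strict Implicit.
Unset Printing Implicit Defensive.

Import Order.TTheory GRing.Theory Num.Theory numFieldNormedType.Exports.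
Local Open Scope classical_set_scope.
Local Open Scope complex_scope.
Local Open Scope ring_scope.

(* Sets of complex numbers have type [set R[i]^o]: the alias [R[i]^o] of the
   field [R[i]] is the one that carries the norm topology.
   Sequences in {0,1}^N are encoded as [nat -> bool], booleans being coerced
   to 0 and 1. *)

(* [Num.truncn] is the integer part of a nonnegative real, as a natural number;
   it is only used at nonnegative arguments. *)
Definition I_beta (R : realType) (beta x : R) : nat := Num.truncn (beta * x).

Definition T_beta (R : realType) (beta x : R) : R :=
  beta * x - (I_beta beta x)%:R.

Definition tau (R : realType) (beta : R) (E : nat -> bool) (x : R) : R :=
  (E (I_beta beta x))%:R + (-1) ^+ E (I_beta beta x) * T_beta beta x.

Definition digit (R : realType) (beta : R) (E : nat -> bool) (x : R)
    (n : nat) : nat :=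
  (E (I_beta beta (iter n (tau beta E) x)) +
   I_beta beta (iter n (tau beta E) x))%N.

Definition esign (R : realType) (beta : R) (E : nat -> bool) (x : R)
    (n : nat) : R :=
  (-1) ^+ E (I_beta beta (iter n (tau beta E) x)).

Definition ssign (R : realType) (beta : R) (E : nat -> bool) (x : R)
    (n : nat) : R :=
  \prod_(i < n) esign beta E x i.

Definition EP (R : realType) (beta : R) : set R :=
  [set k%:R / beta | k in [set k : nat | (1 <= k <= Num.truncn beta)%N]].

Definition is_base (R : realType) (beta : R) : Prop :=
  1 < beta /\ beta \isn't a Num.int.

Definition gen_parry (R : realType) (beta : R) (E : nat -> bool) : Prop :=
  finite_set [set iter n (tau beta E) 1 | n in [set: nat]].

Definition simple_parry (R : realType) (beta : R) (E : nat -> bool) : Prop :=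
  exists2 n, (1 <= n)%N & EP beta (iter n (tau beta E) 1).

Definition is_first_EP_time (R : realType) (beta : R) (E : nat -> bool)
    (N : nat) : Prop :=
  [/\ (1 <= N)%N, EP beta (iter N (tau beta E) 1) &
      forall n, (1 <= n)%N -> EP beta (iter n (tau beta E) 1) -> (N <= n)%N].

Definition is_minpoly_rat (R : realType) (beta : R) (p : {poly rat}) : Prop :=
  [/\ p \is monic, root (map_poly ratr p) beta &
      forall q : {poly rat}, q != 0 -> root (map_poly ratr q) beta ->
        (size p <= size q)%N].

Definition galois_conjugate (R : realType) (beta : R) (z : R[i]) : Prop :=
  z != beta%:C /\
  exists2 p : {poly rat}, is_minpoly_rat beta p & root (map_poly ratr p) z.

Definition Phi (R : realType) (E : nat -> bool) : set R[i]^o :=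
  closure [set z : R[i]^o | exists beta : R,
    [/\ is_base beta, simple_parry beta E & galois_conjugate beta z]].

Arguments Phi R E : clear implicits.

Definition Phi_hat (R : realType) (E : nat -> bool) : set R[i]^o :=
  closure [set z : R[i]^o | exists beta : R,
    [/\ is_base beta, gen_parry beta E & galois_conjugate beta z]].

Arguments Phi_hat R E : clear implicits.

Definition unit_disk (R : realType) : set R[i]^o := [set z | `|z| < 1].

Arguments unit_disk R : clear implicits.

Definition phi_term (R : realType) (beta : R) (E : nat -> bool) (z : R[i])
    (n : nat) : R[i]^o :=
  (ssign beta E 1 n * (digit beta E 1 n)%:R)%:C * z ^+ n.+1.

(* [phi_at beta E z v]: z is in the domain of phi_{tau_{beta,E}} and v is the
   value there.  In the non-simple Parry case phi is the rational function
   extending the power series: z is in its domain iff it has a representation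
   P / Q whose denominator does not vanish at z. *)
Variant phi_at (R : realType) (beta : R) (E : nat -> bool) (z : R[i]) :
    R[i] -> Prop :=
| PhiSimple (N : nat) of is_first_EP_time beta E N :
    phi_at beta E z
      (\sum_(n < N) phi_term beta E z n +
       (beta * iter N (tau beta E) 1 * ssign beta E 1 N)%:C * z ^+ N.+1)
| PhiParry (P Q : {poly R[i]}) of
    ~ simple_parry beta E & gen_parry beta E &
    (forall w : R[i], unit_disk R w -> Q.[w] != 0 ->
       series (phi_term beta E w) @ \oo --> (P.[w] / Q.[w] : R[i]^o)) &
    Q.[z] != 0 :
    phi_at beta E z (P.[z] / Q.[z])
| PhiSeries (v : R[i]^o) of
    ~ simple_parry beta E & ~ gen_parry beta E & unit_disk R z &
    series (phi_term beta E z) @ \oo --> v :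
    phi_at beta E z v.

Definition Phi_star (R : realType) (E : nat -> bool) : set R[i]^o :=
  closure [set y : R[i]^o | exists (beta : R) (z v : R[i]),
    [/\ is_base beta, phi_at beta E z v, 1 - v = 0, z != (beta^-1)%:C &
        y = z^-1]].

Arguments Phi_star R E : clear implicits.

(* The power series 1 + a_1 z + a_2 z^2 + ... of F_I are represented by their
   coefficient sequences. *)
Definition F_ (R : realType) (I : set R) : set (nat -> R) :=
  [set a | a 0%N = 1 /\ forall n, (1 <= n)%N -> I (a n)].

Definition G_ (R : realType) (I : set R) : set R[i]^o :=
  [set z | unit_disk R z /\ exists2 a : nat -> R, F_ I a &
    series (fun n => (a n)%:C * z ^+ n : R[i]^o) @ \oo --> (0 : R[i]^o)].

Definition invset (R : realType) (A : set R[i]^o) : set R[i]^o :=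
  [set z^-1 | z in A].

Definition E_alt (n : nat) : bool := odd n.

(* Main.v *)
(* With c_n = s_n tau^n(1) the relation beta tau^n(1) = d_n + e_n tau^(n+1)(1)
   telescopes to 1 - phi(z) = (1 - beta z) \sum_n c_n z^n with |c_n| <= 1, which
   puts every conjugate outside the closed unit disk into G_[-1,1]^-1; that set
   is closed together with the disk by compactness of [-1,1]^N.
   Conversely, let w be a root of a monic real polynomial of degree N whose other
   coefficients a_n lie in [-1,1]; such w are dense in the disk and in G^-1.
   For large q, take digits d_0 = 4q and d_n = 2 (mod 4) close to 4q|a_n|, with the
   signs of the a_n.  They are the digits of a simple beta close to 4q with
   c_n = a_n + O(1/q), so the cofactor \sum_n c_n w^(N-n) has a root near w, and
   1 - phi (reversed) is the minimal polynomial of beta by Eisenstein at 2. *)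
Require Import Defs.
From mathcomp Require Import all_boot all_order all_algebra.
From mathcomp Require Import all_classical all_reals all_analysis complex.
From mathcomp Require Import ring lra zify.
Import Order.TTheory GRing.Theory Num.Theory numFieldNormedType.Exports.
Local Open Scope classical_set_scope.
Local Open Scope ring_scope.
Local Open Scope complex_scope.

Set Implicit Arguments.
Unset Strict Implicit.
Unset Printing Implicit Defensive.

(** * Reversed polynomials and the factorization of 1 - phi *)

Section RevPoly.
Variable A : nzRingType.
Implicit Types a : nat -> A.

(** [X^n] times the partial sum of [\sum_i a i z^i] up to degree [n], taken at [z = 1/X]: the
    reversal makes [a 0] the leading coefficient. *)
Definition revpoly a n : {poly A} := \poly_(i < n.+1) a (n - i)%N.

Lemma coef_revpoly a n i : (revpoly a n)`_i = if (i <= n)%N then a (n - i)%N else 0.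
Proof. by rewrite coef_poly ltnS. Qed.

Lemma revpoly0 a : revpoly a 0 = (a 0%N)%:P.
Proof.
by apply/polyP => -[|i]; rewrite coef_revpoly coefC.
Qed.

Lemma revpolyS a n : revpoly a n.+1 = revpoly a n * 'X + (a n.+1)%:P.
Proof.
apply/polyP => -[|i]; rewrite coefD coefMX coefC coef_revpoly /= ?add0r //.
by rewrite coef_revpoly ltnS subSS addr0.
Qed.

Lemma size_revpoly a n : a 0%N != 0 -> size (revpoly a n) = n.+1.
Proof. by move=> a0; rewrite size_poly_eq //= subnn. Qed.

Lemma monic_revpoly a n : a 0%N = 1 -> revpoly a n \is monic.
Proof.
move=> a0; rewrite monicE lead_coefE size_revpoly ?a0 ?oner_eq0 //.
by rewrite coef_revpoly leqnn subnn a0.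
Qed.

Lemma horner_revpoly a n w :
  (revpoly a n).[w] = \sum_(i < n.+1) a i * w ^+ (n - i).
Proof.
rewrite horner_poly (reindex_inj rev_ord_inj) /=.
apply: eq_bigr => i _; rewrite subSS subKn // -ltnS; exact: ltn_ord.
Qed.

End RevPoly.

Lemma map_revpoly (A B : nzRingType) (f : {rmorphism A -> B}) a n :
  map_poly f (revpoly a n) = revpoly (f \o a) n.
Proof.
apply/polyP => i; rewrite coef_map !coef_revpoly.
by case: ifP => // _; exact: raddf0.
Qed.

Lemma eq_revpoly (A : nzRingType) (a b : nat -> A) n :
  (forall i, (i <= n)%N -> a i = b i) -> revpoly a n = revpoly b n.
Proof.
by move=> ab; apply/polyP => i; rewrite !coef_revpoly; case: ifP => // _; rewrite ab ?leq_subr.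
Qed.

Lemma horner_revpolyV (K : fieldType) (a : nat -> K) n w : w != 0 ->
  (revpoly a n).[w] = w ^+ n * \sum_(i < n.+1) a i * w^-1 ^+ i.
Proof.
move=> w0; rewrite horner_revpoly mulr_sumr; apply: eq_bigr => i _.
have iN : (i <= n)%N by rewrite -ltnS ltn_ord.
by rewrite mulrCA exprVn -exprB ?unitfE.
Qed.

(* The coefficients of [1 - \sum_n D n z^(n+1)]. *)
Definition digit_coef (A : nzRingType) (D : nat -> A) (n : nat) : A :=
  if n is m.+1 then - D m else 1.

Lemma horner_digitS (A : comNzRingType) (D : nat -> A) n b :
  (revpoly (digit_coef D) n.+1).[b] = b * (revpoly (digit_coef D) n).[b] - D n.
Proof. by rewrite revpolyS hornerMXaddC mulrC. Qed.

Lemma map_digit_coef (A B : nzRingType) (f : {rmorphism A -> B}) D n :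
  map_poly f (revpoly (digit_coef D) n) = revpoly (digit_coef (f \o D)) n.
Proof.
rewrite map_revpoly; apply: eq_revpoly => -[|i] _ /=; first by rewrite rmorph1.
by rewrite rmorphN.
Qed.

Section Factorization.
Variables (A : comNzRingType) (beta : A) (c D : nat -> A).
Hypothesis c0 : c 0%N = 1.

(** Synthetic division by [X - beta]: the recurrence for [c] is the Horner scheme, so the [c n] are
    the coefficients of the quotient and [c N.+1] is the remainder. *)
Lemma digit_poly_factor N (cS : forall n, (n <= N)%N -> beta * c n = D n + c n.+1) :
  revpoly (digit_coef D) N.+1 = revpoly c N * ('X - beta%:P) + (c N.+1)%:P.
Proof.
elim: N cS => [|N IH] cS.
  rewrite revpolyS !revpoly0 c0 /= !mul1r; have /= := cS 0%N isT; rewrite c0 mulr1 => ->.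
  by rewrite polyCD; ring.
rewrite revpolyS IH /=; last by move=> n nN; apply: cS; exact: leqW.
rewrite (revpolyS c N).
have -> : D N.+1 = beta * c N.+1 - c N.+2 by rewrite cS // addrK.
by rewrite opprB polyCB polyCM; ring.
Qed.

(** The same telescoping in the variable [z]; the remainder becomes [c N z^N], which is negligible
    in the disk once [c] is bounded. *)
Lemma digit_series_factor N z (cS : forall n, (n < N)%N -> beta * c n = D n + c n.+1) :
  1 - \sum_(n < N) D n * z ^+ n.+1 =
  (1 - beta * z) * (\sum_(n < N) c n * z ^+ n) + c N * z ^+ N.
Proof.
elim: N cS => [|N IH] cS; first by rewrite !big_ord0 c0 mulr0 add0r expr0 mulr1 subr0.
rewrite !big_ord_recr /= opprD addrA IH; last by move=> n nN; apply: cS; exact: leqW.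
have -> : c N.+1 = beta * c N - D N by rewrite cS // addrC addKr.
by rewrite !exprS; ring.
Qed.

End Factorization.

(** * Signs, digits and coefficients attached to the orbit of 1 *)

Section Orbit.
Variables (R : realType) (beta : R) (E : nat -> bool).

(* The coefficients [s_n tau^n(1)] of [(1 - phi(z)) / (1 - beta z)]. *)
Definition orbit_coef n : R := ssign beta E 1 n * iter n (tau beta E) 1.

Definition signed_digit n : R := ssign beta E 1 n * (digit beta E 1 n)%:R.

(** On a negative branch [tau] is [1 - T_beta]; raising the digit by 1 compensates, so one formula
    serves both signs. *)
Lemma mul_tau x : beta * x = (E (I_beta beta x) + I_beta beta x)%:R
   + (-1) ^+ E (I_beta beta x) * tau beta E x.
Proof.
by rewrite /tau /T_beta; case: (E _); rewrite /= ?expr1 ?expr0 natrD; ring.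
Qed.

Lemma ssignS n : ssign beta E 1 n.+1 = ssign beta E 1 n * esign beta E 1 n.
Proof. by rewrite /ssign big_ord_recr. Qed.

Lemma orbit_coef0 : orbit_coef 0 = 1.
Proof. by rewrite /orbit_coef /ssign big_ord0 mulr1. Qed.

Lemma orbit_coefS n : beta * orbit_coef n = signed_digit n + orbit_coef n.+1.
Proof.
rewrite /orbit_coef /signed_digit ssignS mulrCA mul_tau mulrDr; congr (_ + _).
by rewrite mulrA.
Qed.

Lemma normr_ssign n : `|ssign beta E 1 n| = 1.
Proof.
by rewrite normr_prod big1 // => i _; rewrite /esign normrX normrN1 expr1n.
Qed.

Lemma ssign_sqr n : ssign beta E 1 n * ssign beta E 1 n = 1.
Proof. by rewrite -expr2 -real_normK ?num_real// normr_ssign expr1n. Qed.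

(** Integrality of the signed digits is what turns a repetition in the orbit into an integer
    polynomial vanishing at [beta]. *)
Lemma signed_digit_int :
  exists D : nat -> int, forall n, signed_digit n = (D n)%:~R.
Proof.
exists (fun n => (\prod_(i < n) (-1) ^+ E (I_beta beta (iter i (tau beta E) 1)))
   * (digit beta E 1 n)%:Z) => n.
rewrite rmorphM /= rmorph_prod; congr (_ * _).
by apply: eq_bigr => i _; rewrite /esign rmorphXn /= rmorphN1.
Qed.

Hypothesis beta_gt1 : 1 < beta.

Lemma tau_itv x : 0 <= x -> 0 <= tau beta E x <= 1.
Proof.
move=> x0; have bx0 : 0 <= beta * x by rewrite mulr_ge0 // ltW // (lt_trans ltr01).
have := truncn_itv bx0; rewrite /tau /T_beta /I_beta -natr1.
by case: (E _); rewrite /= ?expr1 ?expr0 => /andP[? ?]; apply/andP; split; lra.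
Qed.

Lemma orbit_itv n : 0 <= iter n (tau beta E) 1 <= 1.
Proof.
elim: n => [|n /andP[IH _]]; first by rewrite /= ler01 lexx.
by rewrite iterS tau_itv.
Qed.

Lemma normr_orbit_coef n : `|orbit_coef n| <= 1.
Proof.
rewrite /orbit_coef normrM normr_ssign mul1r.
by have /andP[? ?] := orbit_itv n; rewrite ger0_norm.
Qed.

End Orbit.

(** * Minimal polynomials and roots *)

Lemma map_ratr_intr (K : numFieldType) (p : {poly int}) :
  map_poly (ratr : rat -> K) (map_poly intr p) = map_poly intr p.
Proof. by apply/polyP => i; rewrite !coef_map /= ratr_int. Qed.

Lemma minpoly_dvdp (R : realType) (beta : R) (p q : {poly rat}) :
  is_minpoly_rat beta p -> root (map_poly ratr q) beta -> p %| q.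
Proof.
case=> pmon pbeta pmin qbeta; apply/modp_eq0P/eqP/negPn/negP => r0.
have p0 : p != 0 by exact: monic_neq0.
have : (size (q %% p)%R < size p)%N by rewrite ltn_modp.
rewrite ltnNge pmin //.
have -> : q %% p = q - q %/ p * p by rewrite {2}(divp_eq q p) addrC addKr.
rewrite rmorphB rmorphM /= rootE hornerD hornerN hornerM.
by rewrite (rootP pbeta) (rootP qbeta) mulr0 subr0.
Qed.

(** The gcd of [p] and [q] still vanishes at [beta], so it is not constant, and irreducibility makes
    it associate to [p]. *)
Lemma irreducible_minpoly (R : realType) (beta : R) (p : {poly rat}) :
  irreducible_poly p -> p \is monic -> root (map_poly ratr p) beta ->
  is_minpoly_rat beta p.
Proof.
move=> [_ pirr] pmon pbeta; split=> // q q0 qbeta.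
have gbeta : root (map_poly (ratr : rat -> R) (gcdp p q)) beta.
  by rewrite gcdp_map root_gcd pbeta.
have g0 : gcdp p q != 0 by rewrite gcdp_eq0 negb_and q0 orbT.
have : size (gcdp p q) != 1%N.
  apply/negP => /size_poly1P[c c0 gc]; move: gbeta.
  by rewrite gc map_polyC rootC /= fmorph_eq0 (negPf c0).
move=> /pirr /(_ (dvdp_gcdl _ _)) /eqp_size <-.
by rewrite dvdp_leq // dvdp_gcdr.
Qed.

Lemma galois_conjugate_root (R : realType) (beta : R) (w : R[i]) (p : {poly int}) :
  galois_conjugate beta w -> root (map_poly intr p) beta ->
  root (map_poly intr p) w.
Proof.
case=> _ [m mmin mw] pbeta.
rewrite -map_ratr_intr; have : m %| map_poly intr p.
  by apply: minpoly_dvdp mmin _; rewrite map_ratr_intr.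
by move=> /dvdpP[r ->]; rewrite rmorphM rootM mw orbT.
Qed.

(** [|p(w)|] is the product of the distances from [w] to the roots; if all were at least [e], it
    would be at least [e] to the degree. *)
Lemma monic_root_near (C : numClosedFieldType) (p : {poly C}) (e : C) w :
  p \is monic -> (1 < size p)%N -> 0 <= e -> `|p.[w]| < e ^+ (size p).-1 ->
  exists2 v, root p v & `|w - v| < e.
Proof.
move=> pmon psz e0; have [r pE] := closed_field_poly_normal p.
move: pE; rewrite (monicP pmon) scale1r => pE.
rewrite pE size_prod_XsubC /= horner_prod normr_prod.
case: (boolP (has (fun v => `|w - v| < e) r)) => [/hasP[v vr ve] _|].
  by exists v => //; rewrite root_prod_XsubC.
move=> /hasPn H; rewrite real_ltNge ?ger0_real ?exprn_ge0 ?prodr_ge0 // => /negP[].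
elim: r H {pE} => [|v r IH] H; first by rewrite big_nil.
rewrite big_cons /= exprS hornerXsubC ler_pM ?exprn_ge0 ?IH //.
  by rewrite real_leNgt ?ger0_real // H ?mem_head.
by move=> u ur; rewrite H // inE ur orbT.
Qed.

(** * Construction of a simple base with prescribed digits *)

(** Evenness of [d] is the point: the integer part of [beta x] is [d] or [d - 1] according to the
    sign, so [E_alt] reads off exactly the wanted sign. Even digits thus allow any sign pattern. *)
Lemma tau_altE (R : realType) (beta x y : R) (d : nat) (b : bool) :
  ~~ odd d -> (0 < d)%N -> 0 < y < 1 -> beta * x = d%:R + (-1) ^+ b * y ->
  tau beta E_alt x = y /\ E_alt (I_beta beta x) = b.
Proof.
move=> dodd d0 /andP[y0 y1] bx.
have IE : I_beta beta x = (d - b)%N.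
  apply: truncn_def; rewrite bx -natr1 natrB ?(leq_trans (leq_b1 b)) //.
  by case: b {bx} => /=; rewrite ?expr1 ?expr0; lra.
have Eb : E_alt (I_beta beta x) = b.
  by rewrite IE /E_alt oddB ?(leq_trans (leq_b1 b)) // (negPf dodd); case: b {bx IE}.
split=> //; rewrite /tau Eb /T_beta bx IE natrB ?(leq_trans (leq_b1 b)) //.
by case: b {bx IE Eb} => /=; rewrite ?expr1 ?expr0; ring.
Qed.

(** [b n] is the accumulated sign: step [n] has sign [b n (+) b n.+1], and the product of the steps
    telescopes from [b 0 = false]. *)
Lemma orbit_altE (R : realType) (beta : R) (x : nat -> R) (d : nat -> nat)
    (b : nat -> bool) N :
  b 0%N = false -> x 0%N = 1 ->
  (forall n, (n < N)%N -> ~~ odd (d n) && (0 < d n)%N) ->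
  (forall n, (n < N)%N -> 0 < x n.+1 < 1) ->
  (forall n, (n < N)%N ->
     beta * x n = (d n)%:R + (-1) ^+ (b n (+) b n.+1) * x n.+1) ->
  forall n, (n <= N)%N ->
    iter n (tau beta E_alt) 1 = x n /\ ssign beta E_alt 1 n = (-1) ^+ b n.
Proof.
move=> b0 x0 deven xitv xS; elim=> [|n IH] nN.
  by rewrite /ssign big_ord0 b0 x0.
have [xn sn] := IH (ltnW nN); have /andP[dodd d0] := deven n nN.
have [tE bE] := tau_altE dodd d0 (xitv n nN) (xS n nN).
rewrite ssignS sn /esign !iterS /= xn tE bE; split=> //.
by rewrite -signr_addb addbA addbb.
Qed.

(** Serves to show both that [beta] is not an integer and that the orbit avoids [EP] before time
    [N]. *)
Lemma natr_neq_between (R : realFieldType) (y : R) (b : bool) (d j : nat) :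
  0 < y < 1 -> d%:R + (-1) ^+ b * y <> j%:R.
Proof.
move=> /andP[y0 y1] dj.
have : (d < j + b < d.+1)%N.
  rewrite -!(ltr_nat R) -natr1 natrD -dj.
  by case: b {dj} => /=; rewrite ?expr1 ?expr0; apply/andP; split; lra.
lia.
Qed.

(** Intermediate values: the recurrence [Q_{n+1}(b) = b Q_n(b) - D n] keeps the value at [k - 1] at
    most -1 and the value at [k + 1] at least 1, because [|D n| <= k - 2] after the leading
    digit. *)
Lemma digit_root (R : realType) (D : nat -> R) (k : R) N :
  D 0%N = k -> (forall n, (0 < n)%N -> `|D n| <= k - 2) ->
  exists2 beta, k - 1 < beta < k + 1 & root (revpoly (digit_coef D) N.+1) beta.
Proof.
move=> D0 Dk.
have Qlo n : (revpoly (digit_coef D) n.+1).[k - 1] <= - 1.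
  have k2 : 0 <= k - 2 by exact: le_trans (normr_ge0 _) (Dk 1%N isT).
  elim: n => [|n IH]; rewrite horner_digitS.
    by rewrite revpoly0 hornerC D0 /=; lra.
  by have := Dk n.+1 isT; rewrite ler_norml => /andP[? ?]; nra.
have Qhi n : 1 <= (revpoly (digit_coef D) n.+1).[k + 1].
  have k2 : 0 <= k - 2 by exact: le_trans (normr_ge0 _) (Dk 1%N isT).
  elim: n => [|n IH]; rewrite horner_digitS.
    by rewrite revpoly0 hornerC D0 /=; lra.
  by have := Dk n.+1 isT; rewrite ler_norml => /andP[? ?]; nra.
have [||b] := @poly_ivt _ (revpoly (digit_coef D) N.+1) (k - 1) (k + 1).
- lra.
- by rewrite (le_trans (Qlo N)) ?(le_trans _ (Qhi N)) //; lra.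
move=> /andP[b1 b2] rb; exists b => //.
rewrite !lt_neqAle b1 b2 !andbT; apply/andP; split; apply/negP => /eqP bE; move/rootP: rb.
  by rewrite -bE; have := Qlo N => + H; rewrite H; lra.
by rewrite bE; have := Qhi N => + H; rewrite H; lra.
Qed.

(** The coefficients below the leading one are the [- D n], with [- D N] as constant term, so the
    hypotheses are those of Eisenstein's criterion at 2. *)
Lemma eisenstein2_digits (D : nat -> int) N :
  (forall n, (n <= N)%N -> (2 %| `|D n|)%N) -> ~~ (4 %| `|D N|)%N ->
  irreducible_poly (map_poly (intr : int -> rat) (revpoly (digit_coef D) N.+1)).
Proof.
move=> D2 D4; apply/irreducible_rat_int.
have mon : revpoly (digit_coef D) N.+1 \is monic by exact: monic_revpoly.
have sz : size (revpoly (digit_coef D) N.+1) = N.+2 by rewrite size_revpoly.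
apply: (@eisenstein_crit 2) => //.
- by rewrite sz.
- by rewrite (monicP mon).
- by rewrite coef_revpoly /= dvdzE abszN.
- move=> i; rewrite sz /= => iN; rewrite coef_revpoly (ltnW iN).
  by rewrite subSn -1?ltnS //= dvdzE abszN D2 // leq_subr.
Qed.

(** [4q(x - t) = 4(u - qt) + 2 +/- y - (beta - 4q)x] lies in [[-8, 4]], whence the constant 2. *)
Lemma digit_approx (R : realFieldType) (q t u beta x y : R) (s : bool) :
  1 <= q -> 4 * q - 1 < beta < 4 * q + 1 -> q * t - 2 <= u <= q * t ->
  0 < x < 1 -> 0 <= y <= 1 -> beta * x = 4 * u + 2 + (-1) ^+ s * y ->
  `|x - t| <= 2 / q.
Proof.
move=> q1 /andP[b1 b2] /andP[u1 u2] /andP[x0 x1] /andP[y0 y1] xE.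
have q0 : 0 < q by lra.
have /andP[bx1 bx2] : -1 <= (beta - 4 * q) * x <= 1 by apply/andP; split; nra.
rewrite ler_pdivlMr // -{1}(gtr0_norm q0) -normrM ler_norml.
by move: xE; case: s; rewrite ?expr1 ?expr0 => xE; apply/andP; split; lra.
Qed.

(** [beta] is obtained as a root of the polynomial of the chosen digits; only afterwards is the
    orbit of 1 shown to have these digits. The last claim makes every root of the cofactor other
    than [beta] a conjugate. *)
Lemma exists_simple_base (R : realType) (a : nat -> R) (q N : nat) :
  (0 < N)%N -> (3 <= q)%N -> a 0%N = 1 -> (forall n, `|a n| <= 1) ->
  exists beta : R,
    [/\ q%:R < beta, is_base beta, is_first_EP_time beta E_alt N,
        forall n, (n <= N)%N -> `|orbit_coef beta E_alt n - a n| <= 2 / q%:R &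
        forall w : R[i], w != beta%:C ->
          root (map_poly (real_complex R) (revpoly (orbit_coef beta E_alt) N)) w ->
          galois_conjugate beta w].
Proof.
move=> N0 q3 a0 a1.
(* The digits after [d 0] are 2 mod 4, for Eisenstein at 2; the margin [q - 2] keeps the orbit
   strictly inside ]0, 1[, so that no earlier iterate meets EP. *)
pose u n := minn (Num.truncn (q%:R * `|a n|)) (q - 2).
pose d n := if n == 0%N then (4 * q)%N else (4 * u n + 2)%N.
pose b n := if n == 0%N then false else a n < 0.
pose D n : int := (-1) ^+ b n * (d n)%:Z.
pose DR n : R := (D n)%:~R.
have qR : 3 <= q%:R :> R by rewrite (ler_nat R 3).
have DRE n : DR n = (-1) ^+ b n * (d n)%:R.
  by rewrite /DR /D rmorphM rmorphXn /= rmorphN1.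
have dS n : d n.+1 = (4 * u n.+1 + 2)%N by [].
have dhi n : (d n.+1 + 6 <= 4 * q)%N.
  by have := geq_minr (Num.truncn (q%:R * `|a n.+1|)) (q - 2); rewrite dS -/(u _); lia.
have dhiR n : (d n.+1)%:R + 6 <= 4 * q%:R :> R.
  by rewrite -natrM -(natrD _ _ 6) ler_nat.
have deven n : ~~ odd (d n) && (0 < d n)%N.
  by rewrite /d; case: eqP => _; apply/andP; split; lia.
have normD n : `|D n|%N = d n by rewrite /D abszMsign.
have [|n n0|beta /andP[blo bhi] bP] := @digit_root R DR (4 * q%:R) N.
- by rewrite DRE /b /d /= natrM mul1r.
- rewrite DRE normrM normrX normrN1 expr1n mul1r normr_nat.
  by case: n n0 => // n _; have := dhiR n; lra.
have b0 : 0 < beta by lra.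
(* Horner values at the root [beta]: they satisfy the recurrence of [orbit_coef], with [c N.+1 = 0],
   before anything is known of the orbit. *)
pose c n := (revpoly (digit_coef DR) n).[beta].
have c0 : c 0%N = 1 by rewrite /c revpoly0 hornerC.
have cS n : beta * c n = DR n + c n.+1 by rewrite /c horner_digitS addrC subrK.
have cN : c N.+1 = 0 by apply/rootP.
pose x n := (-1) ^+ b n * c n.
have x0 : x 0%N = 1 by rewrite /x c0 mulr1.
have xS n : beta * x n = (d n)%:R + (-1) ^+ (b n (+) b n.+1) * x n.+1.
  rewrite /x mulrCA cS DRE mulrDr signrMK mulrA; congr (_ + _ * _).
  by rewrite -signr_addb -addbA addbb addbF.
have xN : beta * x N = (d N)%:R by rewrite xS /x cN !mulr0 addr0.
(* Digits between 2 and [4q - 6], together with [beta > 4q - 1], put [x n] strictly inside []0, 1[]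
   whatever the sign of the next term. *)
have xstep n : (0 < n)%N -> 0 <= x n.+1 <= 1 -> 0 < x n < 1.
  case: n => // n _ /andP[y0 y1].
  have := xS n.+1; have := dhiR n; have : 2 <= (d n.+1)%:R :> R.
    by rewrite (ler_nat R 2) dS; lia.
  case: (b n.+1 (+) b n.+2); rewrite ?expr1 ?expr0 => d2 d6 xE; apply/andP; split.
  - by rewrite -(pmulr_rgt0 _ b0) xE; lra.
  - by rewrite -(ltr_pM2l b0) xE; lra.
  - by rewrite -(pmulr_rgt0 _ b0) xE; lra.
  - by rewrite -(ltr_pM2l b0) xE; lra.
(* Descending induction, starting from [x N.+1 = 0]. *)
have xitv n : (n < N)%N -> 0 < x n.+1 < 1.
  move=> nN; have -> : n.+1 = (N - (N - n.+1))%N by lia.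
  have : (N - n.+1 < N)%N by lia.
  elim: (N - n.+1)%N => [|j IH] jN.
    by apply: xstep; rewrite ?subn0 // /x cN mulr0 lexx ler01.
  apply: xstep; first by lia.
  have -> : (N - j.+1).+1 = (N - j)%N by lia.
  by have /andP[? ?] := IH (ltnW jN); rewrite !ltW.
have bf0 : b 0%N = false by [].
have orb := orbit_altE bf0 x0 (fun n _ => deven n) xitv (fun n _ => xS n).
have oc n : (n <= N)%N -> orbit_coef beta E_alt n = c n.
  by move=> /orb[xn sn]; rewrite /orbit_coef xn sn /x signrMK.
(* [beta = d 0 +/- x 1] with [0 < x 1 < 1] lies strictly between consecutive integers. *)
have bint : beta \isn't a Num.int.
  apply/negP => bi; have : beta \is a Num.nat by rewrite natrEint bi ltW.
  move=> /natrP[j bj]; have := xS 0%N; rewrite x0 mulr1 bj => /esym.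
  by apply: natr_neq_between; exact: xitv.
have dNbeta : (1 <= d N <= Num.truncn beta)%N.
  have /andP[_ -> /=] := deven N; rewrite truncn_ge_nat ?ltW //.
  by rewrite -(prednK N0); have := dhiR N.-1; lra.
exists beta; split.
- by lra.
- by split=> //; lra.
- split=> //.
    exists (d N) => //; have [-> _] := orb N (leqnn N).
    by rewrite -xN mulrC mulKf // gt_eqF.
  (* An earlier visit to [EP] would make [beta x n] an integer. *)
  move=> n n1 [j _ jx]; rewrite leqNgt; apply/negP => nN.
  have [xn _] := orb n (ltnW nN); rewrite xn in jx.
  have := xS n; rewrite -jx mulrC divfK ?gt_eqF // => /esym.
  by apply: natr_neq_between; exact: xitv.
- move=> n nN; rewrite oc //; case: n nN => [|n] nN.
    by rewrite c0 a0 subrr normr0 divr_ge0.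
  have ca : c n.+1 = (-1) ^+ b n.+1 * x n.+1 by rewrite /x signrMK.
  have aa : a n.+1 = (-1) ^+ b n.+1 * `|a n.+1| by rewrite /b /= -realEsign ?num_real.
  rewrite ca {1}aa -mulrBr normrM normrX normrN1 expr1n mul1r.
  have t0 : 0 <= q%:R * `|a n.+1| by rewrite mulr_ge0.
  have t1 : q%:R * `|a n.+1| <= q%:R by rewrite ler_piMr.
  have /andP[tlo thi] := truncn_itv t0.
  have q2 : (q - 2)%:R = q%:R - 2 :> R by rewrite natrB // ltnW.
  (* The floor loses less than 1; the cap [q - 2] loses at most 2 because [|a n| <= 1]. *)
  have [ulo uhi] : q%:R * `|a n.+1| - 2 <= (u n.+1)%:R /\ (u n.+1)%:R <= q%:R * `|a n.+1|.
    rewrite /u; case: leqP => h; split; rewrite ?q2.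
    + by move: thi; rewrite -natr1; lra.
    + by [].
    + by lra.
    + by move: h; rewrite -(ltr_nat R) q2; lra.
  have := xS n.+1; have := xitv n nN; rewrite dS natrD natrM => /andP[z0 z1] xE.
  have yitv : 0 <= x n.+2 <= 1.
    have [nN1|nN1] := ltnP n.+1 N; first by have /andP[? ?] := xitv _ nN1; rewrite !ltW.
    have nE : n.+1 = N by apply/eqP; rewrite eqn_leq nN.
    by rewrite /x nE cN mulr0 lexx ler01.
  by apply: (digit_approx _ _ _ _ yitv xE); rewrite ?blo ?ulo ?z0 //; lra.
- move=> w wb wroot; split=> //.
  exists (map_poly intr (revpoly (digit_coef D) N.+1)).
    apply: irreducible_minpoly.
    + apply: eisenstein2_digits => [n nN|].
        by rewrite normD; have /andP[] := deven n; rewrite dvdn2.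
      by rewrite normD /d gtn_eqF // dvdn_addr ?dvdn_mulr.
    + by apply: monic_map; exact: monic_revpoly.
    + by rewrite map_ratr_intr map_digit_coef.
  rewrite map_ratr_intr map_digit_coef.
  have -> : revpoly (digit_coef (intr \o D)) N.+1 =
      map_poly (real_complex R) (revpoly (digit_coef DR) N.+1).
    by rewrite map_digit_coef; apply: eq_revpoly => -[|i] _ //=; rewrite rmorph_int.
  rewrite (@digit_poly_factor _ beta c DR c0) // cN addr0 rmorphM rootM.
  by rewrite -(eq_revpoly oc) wroot.
Qed.

(** * Approximation by conjugates of simple bases *)

Section ComplexPlane.
Variable R : realType.
Implicit Types (w z : R[i]) (A : set R[i]^o).

Lemma normr_complex_real (x : R) : `|x%:C| = `|x|%:C :> R[i].
Proof. by rewrite normc_def /= expr0n /= addr0 sqrtr_sqr. Qed.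

Lemma normr_complexP w : exists2 r : R, 0 <= r & `|w| = r%:C.
Proof. by rewrite normc_def; eexists; last reflexivity; rewrite sqrtr_ge0. Qed.

(** Positive elements for the order of [R[i]] are real, so radii of balls can be taken in [R]. *)
Lemma complex_gt0P (e : R[i]) : 0 < e -> exists2 d : R, 0 < d & e = d%:C.
Proof.
case: e => a b; rewrite ltcE /= => /andP[/eqP -> a0]; by exists a.
Qed.

Lemma closure_complexP A w :
  closure A w <-> forall e : R, 0 < e -> exists2 y, A y & `|w - y| < e%:C.
Proof.
split=> [clA e e0|H B /nbhs_ballP[e /= e0 eB]].
  have eC : 0 < e%:C :> R[i] by rewrite ltcR.
  have [y [Ay By]] := clA _ (nbhsx_ballx (w : R[i]^o) _ eC).
  by exists y => //; move: By; rewrite -ball_normE.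
have [d d0 dE] := complex_gt0P e0; have [y Ay yd] := H d d0.
by exists y; split=> //; apply: eB; rewrite -ball_normE /= dE.
Qed.

Lemma cvg_complexP (u : nat -> R[i]^o) (l : R[i]^o) :
  u @ \oo --> l <->
  forall e : R, 0 < e -> exists n0, forall n, (n0 <= n)%N -> `|l - u n| < e%:C.
Proof.
split=> [/cvgrPdist_lt ul e e0|H].
  have /ul [n0 _ Hn0] : 0 < e%:C :> R[i] by rewrite ltcR.
  by exists n0 => n; exact: Hn0.
apply/cvgrPdist_lt => _ /complex_gt0P[e e0 ->].
by have [n0 Hn0] := H e e0; exists n0.
Qed.

Lemma closure_closure A : closure (closure A) = closure A.
Proof. exact/esym/closure_id/closed_closure. Qed.

End ComplexPlane.

(** The polynomial counterpart of the zeros of power series with coefficients in [-1,1]: a set whose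
    closure contains the limit region and whose points are limits of conjugates. *)
Definition unit_coef_root (R : realType) : set R[i]^o :=
  [set w | exists (a : nat -> R) N, [/\ a 0%N = 1, forall n, `|a n| <= 1 &
     root (map_poly (real_complex R) (revpoly a N)) w]].

Arguments unit_coef_root R : clear implicits.

Section Approximation.
Variable R : realType.

(** The polynomial [G] of the orbit coefficients differs from that of [a] by O(1/q) in each
    coefficient, so [|G(w)|] is small and [G] has a root near [w]. *)
Lemma unit_coef_root_near (w : R[i]) (e : R) : 0 < e -> unit_coef_root R w ->
  exists beta N (v : R[i]),
    [/\ is_base beta, is_first_EP_time beta E_alt N, galois_conjugate beta v,
        root (map_poly (real_complex R) (revpoly (orbit_coef beta E_alt) N)) v &
        `|w - v| < e%:C].
Proof.
move=> e0 [a [N [a0 a1 wroot]]].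
have N0 : (0 < N)%N.
  case: N wroot => // /rootP; rewrite revpoly0 map_polyC hornerC a0.
  by case=> /eqP; rewrite oner_eq0.
have [r r0 wr] := normr_complexP w.
(* [q > X] serves two ends: the last term forces [|G(w)| < e^N], and [r + e] forces
   [beta > |w| + e], so that the root near [w] is not [beta]. *)
pose X := r + e + 2 * N.+1%:R * (1 + r) ^+ N / e ^+ N.
have M0 : 0 <= 2 * N.+1%:R * (1 + r) ^+ N / e ^+ N.
  by rewrite divr_ge0 ?mulr_ge0 ?exprn_ge0 ?addr_ge0 // ltW.
have X0 : 0 <= X by rewrite /X addr_ge0 // addr_ge0 // ltW.
pose q := (3 + Num.bound X)%N.
have qX : X < q%:R.
  by have := archi_boundP X0; rewrite /q natrD; lra.
have q0 : 0 < q%:R :> R by rewrite ltr0n.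
have q3 : (3 <= q)%N by exact: leq_addr.
have [beta [qb bbase bN ca conj]] := @exists_simple_base _ a q N N0 q3 a0 a1.

set c := orbit_coef beta E_alt in ca conj *.
have c0 : c 0%N = 1 by exact: orbit_coef0.
set G := map_poly (real_complex R) (revpoly c N).
have sz : size G = N.+1 by rewrite size_map_poly size_revpoly // c0 oner_eq0.
have Gmon : G \is monic by apply: monic_map; exact: monic_revpoly.
have Gw : `|G.[w]| <= (N.+1%:R * (2 / q%:R) * (1 + r) ^+ N)%:C.
  have -> : G.[w] = \sum_(i < N.+1) (c i - a i)%:C * w ^+ (N - i).
    rewrite -[LHS]subr0 -[X in _ - X](rootP wroot) /G !map_revpoly !horner_revpoly.
    by rewrite -sumrB; apply: eq_bigr => i _; rewrite -mulrBl /= rmorphB.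
  apply: le_trans (ler_norm_sum _ _ _) _.
  apply: (@le_trans _ _ (\sum_(i < N.+1) (2 / q%:R * (1 + r) ^+ N)%:C)).
    apply: ler_sum => i _; rewrite normrM normrX wr normr_complex_real -rmorphXn -rmorphM lecR.
    apply: ler_pM => //; first by rewrite exprn_ge0.
      by apply: ca; rewrite -ltnS.
    apply: (@le_trans _ _ ((1 + r) ^+ (N - i))).
      by rewrite lerXn2r ?nnegrE ?addr_ge0 // lerDr.
    by rewrite ler_weXn2l ?leq_subr // lerDl.
  by rewrite -rmorph_sum lecR sumr_const card_ord -[leLHS]mulr_natl !mulrA.
have [|||v vroot ve] := @monic_root_near _ G e%:C w Gmon.
- by rewrite sz ltnS.
- by rewrite ler0c ltW.
- rewrite sz /= -rmorphXn; apply: le_lt_trans Gw _; rewrite ltcR.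
  have : 2 * N.+1%:R * (1 + r) ^+ N / e ^+ N < q%:R by move: qX; rewrite /X; lra.
  rewrite ltr_pdivrMr ?exprn_gt0 // => qe.
  rewrite [X in X < _](_ : _ = 2 * N.+1%:R * (1 + r) ^+ N / q%:R); last by ring.
  by rewrite ltr_pdivrMr // [ltRHS]mulrC.
have vb : v != beta%:C.
  apply/negP => /eqP vE; move: ve; rewrite vE => ve.
  have : `|beta%:C| <= `|beta%:C - w| + `|w| by rewrite -{1}(subrK w beta%:C) ler_normD.
  have b0 : 0 < beta by exact: lt_trans q0 qb.
  rewrite normr_complex_real distrC wr gtr0_norm // => Hb.
  have : beta%:C < e%:C + r%:C by apply: le_lt_trans Hb _; rewrite ltrD2r.
  by rewrite -rmorphD ltcR; move: qX; rewrite /X; lra.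
by exists beta, N, v; split=> //; exact: conj.
Qed.

End Approximation.

(** * Conjugates lie in the limit region *)

Definition limit_region (R : realType) : set R[i]^o :=
  closure (unit_disk R) `|` invset (G_ `[(-1 : R), 1]).

Arguments limit_region R : clear implicits.

Section Domains.
Variable R : realType.
Implicit Types (w z : R[i]) (beta : R) (E : nat -> bool).

Lemma closure_unit_diskE : closure (unit_disk R) = [set w : R[i]^o | `|w| <= 1].
Proof.
apply/seteqP; split=> w /= => [/closure_complexP clw|w1].
  have [r r0 wr] := normr_complexP w; rewrite wr -(rmorph1 (real_complex R)) lecR.
  rewrite leNgt; apply/negP => r1.
  have [|y] := clw (r - 1); first by rewrite subr_gt0.
  rewrite /unit_disk /= => y1 wy.
  have : `|w| < (r - 1)%:C + 1.
    by rewrite -(subrK y w) (le_lt_trans (ler_normD _ _)) // ltrD.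
  by rewrite rmorphB rmorph1 subrK wr ltxx.
apply/closure_complexP => e e0.
(* This [t] is below both [e] and 1, so multiplying [w] by [1 - t] enters the open disk at distance
   less than [e]. *)
pose t := e / (1 + e).
have t0 : 0 < t by rewrite divr_gt0 // addr_gt0.
have te : t < e by rewrite ltr_pdivrMr ?addr_gt0 // ltr_pMr // ltrDl.
have t1 : t < 1 by rewrite ltr_pdivrMr ?addr_gt0 // mul1r ltrDr.
exists ((1 - t)%:C * w).
  rewrite /unit_disk /= normrM normr_complex_real (@ger0_norm _ (1 - t)) ?subr_ge0 ?(ltW t1) //.
  have t1' : (1 - t)%:C < 1 :> R[i].
    by rewrite -(rmorph1 (real_complex R)) ltcR ltrBlDr ltrDl.
  apply: le_lt_trans t1'; rewrite ler_piMr // ler0c subr_ge0 ltW //.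
rewrite rmorphB rmorph1 mulrBl mul1r opprB addrCA subrr addr0 normrM normr_complex_real.
rewrite (gtr0_norm t0); apply: (@le_lt_trans _ _ t%:C); last by rewrite ltcR.
by rewrite ler_piMr // ler0c ltW.
Qed.

(** When [|z| >= 1] the inverse lies in the closed disk, so only points inside the disk require a
    power series. *)
Lemma limit_region_inv z : (unit_disk R z -> G_ `[(-1 : R), 1] z) ->
  limit_region R z^-1.
Proof.
move=> Gz; have [r r0 zr] := normr_complexP z.
have [z1|z1] := ltP r 1.
  right; exists z => //; apply: Gz.
  by rewrite /unit_disk /= zr -(rmorph1 (real_complex R)) ltcR.
left; rewrite closure_unit_diskE /= normfV zr -fmorphV -(rmorph1 (real_complex R)) lecR.
by rewrite invf_le1 // (lt_le_trans ltr01).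
Qed.

Lemma G_of_partial_sums z (a : nat -> R) : unit_disk R z ->
  a 0%N = 1 -> (forall n, `|a n| <= 1) ->
  (fun n => \sum_(i < n) (a i)%:C * z ^+ i : R[i]^o) @ \oo --> (0 : R[i]^o) ->
  G_ `[(-1 : R), 1] z.
Proof.
move=> z1 a0 a1 az; split=> //; exists a.
  by split=> // n _; rewrite /= in_itv /= -ler_norml.
rewrite (_ : series _ = (fun n => \sum_(i < n) (a i)%:C * z ^+ i)) //.
by apply/funext => n; rewrite /series /= big_mkord.
Qed.

Lemma cvg0_geometric (u : nat -> R[i]^o) (B r : R) : 0 <= r < 1 ->
  (forall n, `|u n.+1| <= (B * r ^+ n)%:C) -> u @ \oo --> (0 : R[i]^o).
Proof.
move=> /andP[r0 r1] uB; apply/cvg_complexP => e e0.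
have : (fun n => B * r ^+ n) @ \oo --> (0 : R).
  rewrite -[X in _ --> X](mulr0 B); apply: cvgMr; apply: cvg_expr.
  by rewrite ger0_norm.
move/cvgrPdist_lt => /(_ e e0)[n0 _ Hn0].
exists n0.+1 => -[//|n] nn; rewrite sub0r normrN (le_lt_trans (uB n)) // ltcR.
apply: le_lt_trans (Hn0 n nn); rewrite sub0r normrN; exact: ler_norm.
Qed.

Lemma unit_disk_real z : unit_disk R z -> exists2 r : R, 0 <= r < 1 & `|z| = r%:C.
Proof.
have [r r0 zr] := normr_complexP z; rewrite /unit_disk /= zr => z1; exists r => //.
by rewrite r0 -ltcR rmorph1.
Qed.

Lemma phi_series_factor beta E N z :
  1 - \sum_(n < N) phi_term beta E z n =
  (1 - beta%:C * z) * (\sum_(n < N) (orbit_coef beta E n)%:C * z ^+ n)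
  + (orbit_coef beta E N)%:C * z ^+ N.
Proof.
apply: (@digit_series_factor _ beta%:C (fun n => (orbit_coef beta E n)%:C)
  (fun n => (signed_digit beta E n)%:C)).
  by rewrite orbit_coef0 rmorph1.
by move=> n _; rewrite -rmorphM orbit_coefS rmorphD.
Qed.

(** The closing term of [phi] is [beta c_N z^(N+1)]; it combines with the remainder [c_N z^N] into
    one more multiple of [1 - beta z], so the factorization is exact. *)
Lemma phi_simple_factor beta E N z :
  1 - (\sum_(n < N) phi_term beta E z n +
       (beta * iter N (tau beta E) 1 * ssign beta E 1 N)%:C * z ^+ N.+1) =
  (1 - beta%:C * z) * (\sum_(n < N.+1) (orbit_coef beta E n)%:C * z ^+ n).
Proof.
have -> : beta * iter N (tau beta E) 1 * ssign beta E 1 N = beta * orbit_coef beta E N.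
  by rewrite /orbit_coef mulrA mulrAC.
rewrite opprD addrA phi_series_factor big_ord_recr /= [(beta * _)%:C]rmorphM exprS /=.
by ring.
Qed.

Lemma one_sub_beta_neq0 beta z : 1 < beta -> z != (beta^-1)%:C ->
  1 - beta%:C * z != 0.
Proof.
move=> b1; apply: contra_neq => /eqP; rewrite subr_eq0 => /eqP bz.
have b0 : beta%:C != 0 :> R[i] by rewrite fmorph_eq0 gt_eqF // (lt_trans ltr01).
by apply: (mulfI b0); rewrite -bz -rmorphM divff ?rmorph1 // -(fmorph_eq0 (real_complex R)).
Qed.

(** Inside the disk the remainder [c_N z^N] tends to 0, so dividing by [1 - beta z], nonzero here,
    makes the series of the [c n] vanish at [z]. *)
Lemma phi_eq1_G beta E z : 1 < beta -> unit_disk R z -> z != (beta^-1)%:C ->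
  series (phi_term beta E z) @ \oo --> (1 : R[i]^o) ->
  G_ `[(-1 : R), 1] z.
Proof.
move=> b1 z1 zb phi1.
apply: (G_of_partial_sums z1 (orbit_coef0 beta E) (normr_orbit_coef E b1)).
have k0 := one_sub_beta_neq0 b1 zb.
have [r /andP[r0 r1] zr] := unit_disk_real z1.
rewrite (_ : (fun _ => _) = (fun n => (1 - beta%:C * z)^-1 *
   (1 - series (phi_term beta E z) n - (orbit_coef beta E n)%:C * z ^+ n))); last first.
  apply/funext => n; rewrite /series /= big_mkord phi_series_factor addrK.
  by rewrite mulKf.
rewrite -[X in _ --> X](mulr0 (1 - beta%:C * z)^-1).
apply: (@cvgMr R[i]).
rewrite -[X in _ --> X](subr0 0).
apply: (@cvgB _ R[i]^o).
  rewrite -[X in _ --> X](subrr 1).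
  by apply: (@cvgB _ R[i]^o) => //; exact: cvg_cst.
apply: (@cvg0_geometric _ 1 r); first by rewrite r0.
move=> n; rewrite normrM normrX zr normr_complex_real -rmorphXn -rmorphM lecR exprS.
apply: ler_pM; rewrite ?mulr_ge0 ?exprn_ge0 ?normr_orbit_coef //.
by rewrite ler_piMl ?exprn_ge0 // ltW.
Qed.

Lemma phi_at_limit_region E beta z v : is_base beta -> phi_at beta E z v ->
  1 - v = 0 -> z != (beta^-1)%:C -> limit_region R z^-1.
Proof.
move=> [b1 _] phiz /eqP; rewrite subr_eq0 => /eqP v1 zb; apply: limit_region_inv => z1.
case: phiz v1 => {v} [N _|P Q _ _ PQ Qz|v _ _ _ vcvg] v1.
(* Padding the orbit coefficients by zeros beyond [N] turns the polynomial cofactor into a series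
   with coefficients in [-1,1]. *)
- pose a n := if (n <= N)%N then orbit_coef beta E n else 0.
  have /eqP := phi_simple_factor beta E N z; rewrite -v1 subrr eq_sym.
  rewrite mulf_eq0 (negPf (one_sub_beta_neq0 b1 zb)) /= => /eqP S0.
  apply: (@G_of_partial_sums _ a) => //.
  + by rewrite /a orbit_coef0.
  + by move=> n; rewrite /a; case: ifP; rewrite ?normr0 ?ler01 ?normr_orbit_coef.
  apply/cvg_complexP => e e0; exists N.+1 => n nN.
  rewrite (_ : \sum_(_ < _) _ = 0) ?subrr ?normr0 ?ltcR //.
  rewrite -(subnKC nN) big_split_ord /= [X in _ + X]big1 ?addr0.
    by rewrite -[RHS]S0; apply: eq_bigr => i _; rewrite /a -ltnS ltn_ord.
  by move=> i _; rewrite /a leqNgt ltnS leq_addr /= mul0r.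
(* [Q] does not vanish at [z], so in the disk the value of the rational function is the sum of the
   series. *)
- by apply: (phi_eq1_G b1 z1 zb); rewrite v1; exact: PQ.
- by apply: (phi_eq1_G b1 z1 zb); rewrite v1; exact: vcvg.
Qed.

End Domains.

(** * Finite orbits, eventual periodicity and conjugates of Parry numbers *)

Lemma finite_iter_orbit (T : eqType) (f : T -> T) x i m : (i < m)%N ->
  iter m f x = iter i f x -> finite_set [set iter n f x | n in [set: nat]].
Proof.
move=> im mi; apply: (@sub_finite_set _ _ ((fun n => iter n f x) @` `I_m)); last first.
  exact/finite_image/finite_II.
move=> _ [n _ <-]; elim: n => [|n [j jm jn]].
  by exists 0%N => //=; exact: leq_ltn_trans im.
have [jm1|mj] := ltnP j.+1 m; first by exists j.+1 => //; rewrite iterS jn.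
exists i => //; rewrite -mi iterS -jn -iterS; congr (iter _ f x).
by apply/eqP; rewrite eqn_leq mj.
Qed.

Lemma finite_orbit_repeat (T : Type) (x : nat -> T) :
  finite_set [set x n | n in [set: nat]] -> exists i j, (i < j)%N /\ x i = x j.
Proof.
move=> xfin; apply/not_existsP => H.
have xinj : injective x.
  move=> i j xij; case: (ltngtP i j) => // ij; exfalso.
    by apply: (H i); exists j.
  by apply: (H j); exists i.
apply: infinite_nat; have := finite_preimage (in2W xinj) xfin.
by apply: sub_finite_set => n _; exists n.
Qed.

(** If [beta tau^n(1) = k] is an integer, the next iterate is [E_alt k]: either 1, which closes a
    cycle, or 0, which is fixed since [E_alt 0] is false. *)
Lemma simple_gen_parry (R : realType) (beta : R) : 1 < beta ->
  simple_parry beta E_alt -> gen_parry beta E_alt.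
Proof.
move=> b1 [n _ [k _ kn]].
have b0 : beta != 0 by rewrite gt_eqF // (lt_trans ltr01).
have bk : beta * iter n (tau beta E_alt) 1 = k%:R by rewrite -kn mulrC divfK.
have I1 : I_beta beta (iter n (tau beta E_alt) 1) = k.
  by rewrite /I_beta bk natrK.
have x1 : iter n.+1 (tau beta E_alt) 1 = (E_alt k)%:R.
  by rewrite iterS /tau I1 /T_beta I1 bk subrr mulr0 addr0.
case: (boolP (E_alt k)) x1 => _ x1; first exact: (@finite_iter_orbit _ _ _ 0 n.+1).
apply: (@finite_iter_orbit _ _ _ n.+1 n.+2) => //.
by rewrite iterS x1 /tau /T_beta /I_beta mulr0 truncn0 /E_alt /= subrr mulr0 addr0.
Qed.

(** From the repetition on, both tails of the orbit meet the same signs, so the coefficients agree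
    up to the constant sign [s_j s_i]. *)
Lemma orbit_coef_eventually_periodic (R : realType) (beta : R) E i j :
  iter i (tau beta E) 1 = iter j (tau beta E) 1 ->
  exists b : bool, forall k,
    orbit_coef beta E (j + k) = (-1) ^+ b * orbit_coef beta E (i + k).
Proof.
move=> xij.
have xk k : iter (j + k) (tau beta E) 1 = iter (i + k) (tau beta E) 1.
  by rewrite !(addnC _ k) !iterD xij.
pose s := ssign beta E 1.
have sij k : s (j + k)%N = s j * s i * s (i + k)%N.
  elim: k => [|k IH]; first by rewrite !addn0 -mulrA ssign_sqr mulr1.
  by rewrite !addnS /s !ssignS -/(s _) IH /esign xk mulrA.
have : (s j * s i) ^+ 2 == 1 by rewrite exprMn !expr2 !ssign_sqr mulr1.
rewrite sqrf_eq1 => /orP sE.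
have [b bE] : exists b : bool, s j * s i = (-1) ^+ b.
  by case: sE => /eqP ->; [exists false|exists true].
by exists b => k; rewrite /orbit_coef -/(s _) sij xk -mulrA bE.
Qed.

Section EventuallyPeriodic.
Variable R : realType.

Lemma galois_conjugate_limit_region (beta : R) E (w : R[i]) : is_base beta ->
  gen_parry beta E -> galois_conjugate beta w -> limit_region R w.
Proof.
move=> [b1 _] bfin wconj; have wb : w != beta%:C by case: wconj.
have [->|w0] := eqVneq w 0.
  by left; rewrite closure_unit_diskE /= normr0 ler01.
rewrite -(invrK w); apply: limit_region_inv => z1.
have [|i [j [ij xij]]] := @finite_orbit_repeat R (fun n => iter n (tau beta E) 1).
  exact: bfin.
have [b cij] := orbit_coef_eventually_periodic xij.
set c := orbit_coef beta E in cij *.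
have c0 : c 0%N = 1 by exact: orbit_coef0.
have [D DE] := signed_digit_int beta E.
pose DR n : R := (D n)%:~R.
have cS n : beta * c n = DR n + c n.+1 by rewrite orbit_coefS DE.
have Qfac n : revpoly (digit_coef DR) n.+1 =
    revpoly c n * ('X - beta%:P) + (c n.+1)%:P by exact: digit_poly_factor.
(* The integer polynomial [P] kills [beta], hence its conjugate [w]; dividing by
   [w - beta] makes [`|G n|] eventually periodic, so the partial sums [G n / w^n]
   of the power series at [1 / w] tend to 0. *)
pose P := revpoly (digit_coef D) j.+1 - (-1) ^+ b *: revpoly (digit_coef D) i.+1.
have PE : map_poly intr P = (revpoly c j - (-1) ^+ b *: revpoly c i) * ('X - beta%:P).
  rewrite /P rmorphB /= map_polyZ /= rmorphXn /= rmorphN1 !map_digit_coef !Qfac.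
  (* The remainders [c_{j+1}] and [+/- c_{i+1}] of the two divisions cancel. *)
  by have := cij 1%N; rewrite !addn1 => ->; rewrite polyCM -!mul_polyC; ring.
pose G n := (map_poly (real_complex R) (revpoly c n)).[w].
have GS n : G n.+1 = G n * w + (c n.+1)%:C.
  by rewrite /G revpolyS rmorphD rmorphM /= map_polyX map_polyC hornerMXaddC.
(* For [k = 0] this is [P(w) = 0] divided by [w - beta]; the recurrence [GS] and the periodicity of
   [c] propagate it. *)
have Gij k : G (j + k)%N = (-1) ^+ b * G (i + k)%N.
  elim: k => [|k IH]; last first.
    rewrite !addnS !GS IH -!addnS cij rmorphM rmorphXn /= rmorphN1.
    by rewrite mulrDr mulrA.
  have := galois_conjugate_root wconj; move=> /(_ P).
  rewrite PE rootM root_XsubC eqxx orbT => /(_ isT).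
  have -> : map_poly intr P = map_poly (real_complex R) (map_poly intr P).
    by rewrite -map_poly_comp; apply: eq_map_poly => x /=; rewrite rmorph_int.
  rewrite PE rmorphM /= rootM map_polyXsubC root_XsubC (negPf wb) orbF.
  rewrite rootE rmorphB /= linearZ /= hornerD hornerN hornerZ subr_eq0 => /eqP.
  by rewrite !addn0 /G => ->; rewrite rmorphXn /= rmorphN1.
(* An index [n >= j] can be lowered by [j - i] without changing [|G n|], so the first [j] values
   bound all of them. *)
pose B := \sum_(n < j) `|G n|.
have Gbound n : `|G n| <= B.
  have [m] := ubnP n; elim: m n => // m IH n; rewrite ltnS => nm.
  have [nj|jn] := ltnP n j.
    by rewrite /B (bigD1 (Ordinal nj)) //= lerDl sumr_ge0.
  rewrite -(subnKC jn) Gij normrM normrX normrN1 expr1n mul1r; apply: IH.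
  by lia.
have [B0 B0_ge0 BE] : exists2 B0 : R, 0 <= B0 & B = B0%:C.
  have [B0 ? BE] := normr_complexP B; exists B0 => //.
  by rewrite -BE ger0_norm // sumr_ge0.
have [r r01 zr] := unit_disk_real z1.
apply: (G_of_partial_sums z1 c0 (normr_orbit_coef E b1)).
apply: (@cvg0_geometric _ _ B0 r r01) => n.
have -> : \sum_(k < n.+1) (c k)%:C * w^-1 ^+ k = w^-1 ^+ n * G n.
  rewrite /G map_revpoly horner_revpolyV // mulrA -exprMn mulVf // expr1n mul1r.
  by apply: eq_bigr.
by rewrite normrM normrX zr mulrC rmorphM rmorphXn /= -BE ler_wpM2r // exprn_ge0 // -zr.
Qed.

End EventuallyPeriodic.

(** * Closedness of the limit region *)

Section Closedness.
Variable R : realType.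

(** Tychonoff: the sets [A e] generate a filter on a product of segments, as [e] decreases to 0, and
    [a] is a cluster point of it. *)
Lemma sequence_cluster (A : R -> set (nat -> R)) :
  (forall e, 0 < e -> A e !=set0) ->
  (forall e e', e <= e' -> A e `<=` A e') ->
  (forall e a, A e a -> a 0%N = 1 /\ forall n, `|a n| <= 1) ->
  exists a, [/\ a 0%N = 1, forall n, `|a n| <= 1 &
    forall e h N, 0 < e -> 0 < h ->
      exists2 b, A e b & forall n, (n < N)%N -> `|a n - b n| < h].
Proof.
move=> A0 Amono Abound.
(* The factor of index 0 is the single point 1, so the cluster point keeps constant coefficient
   1. *)
pose lo n : R := if n is 0%N then 1 else -1.
pose K n : set R := `[lo n, 1]%classic.
have Kcompact : @compact (prod_topology _) [set f | forall n, K n (f n)].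
  by apply: tychonoff => n; exact: segment_compact.
pose F : set_system (prod_topology (fun _ : nat => R)) := filter_from [set e : R | 0 < e] A.
have FF : ProperFilter F.
  apply: filter_from_proper; last by move=> e /A0.
  apply: filter_from_filter; first by exists 1; exact: ltr01.
  move=> e e' /= e0 e'0; exists (Num.min e e'); first by rewrite /= lt_min e0.
  by move=> a Aa; split; apply: Amono Aa; rewrite ge_min lexx ?orbT.
have FK : F [set f | forall n, K n (f n)].
  exists 1; first exact: ltr01.
  move=> a /Abound[a0 a1] n; rewrite /K /= in_itv /=; have := a1 n.
  by rewrite ler_norml; case: n => [|n] //= ; rewrite a0 lexx.
have [a [Ka clFa]] := Kcompact F FF FK.
have a1 n : `|a n| <= 1.
  have := Ka n; rewrite /K /= in_itv /= ler_norml => /andP[loa ->]; rewrite andbT.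
  by apply: le_trans loa; case: n => [|n] /=; lra.
exists a; split=> //.
  by have := Ka 0%N; rewrite /K /= in_itv /= => ?; apply/eqP; rewrite eq_le andbC.
move=> e h N e0 h0.
pose V : set_system (nat -> R) := nbhs (a : prod_topology (fun _ : nat => R)).
have VF : Filter V by exact: (@nbhs_filter (prod_topology (fun _ : nat => R)) a).
(* Only finitely many coordinates are constrained, so this is a neighbourhood of [a] in the product
   topology. *)
have nb : V [set b | forall n, (n < N)%N -> `|a n - b n| < h].
  elim: N => [|N IH]; first by apply: (@filterS _ V VF setT); [|exact: filterT].
  have aN : V [set b | `|a N - b N| < h].
    have := @proj_continuous nat (fun=> R) N a; move/cvgrPdist_lt => /(_ h h0).
    exact.
  apply: (@filterS _ V VF _ _ _ (filterI IH aN)) => b [bn bN] n.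
  by rewrite ltnS leq_eqVlt => /orP[/eqP ->|/bn].
by have [b [Ab bn]] := clFa _ _ (ex_intro2 _ _ e e0 (@subset_refl _ (A e))) nb; exists b.
Qed.

(** At a zero, a partial sum is the opposite of the tail, which a geometric series bounds. The bound
    depends only on [rho] and [N], hence survives passage to a limit. *)
Lemma zero_partial_sum (a : nat -> R) (z : R[i]) (rho : R) N :
  0 <= rho < 1 -> `|z| <= rho%:C -> (forall n, `|a n| <= 1) ->
  (fun n => \sum_(i < n) (a i)%:C * z ^+ i : R[i]^o) @ \oo --> (0 : R[i]^o) ->
  `|\sum_(i < N) (a i)%:C * z ^+ i| <= (rho ^+ N / (1 - rho))%:C.
Proof.
move=> /andP[rho0 rho1] zrho a1 /cvg_complexP az.
have tail k : `|\sum_(i < N + k) (a i)%:C * z ^+ i - \sum_(i < N) (a i)%:C * z ^+ i|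
    <= (rho ^+ N * (1 - rho ^+ k) / (1 - rho))%:C.
  have r1 : 1 - rho != 0 by rewrite subr_eq0 gt_eqF.
  elim: k => [|k IH]; first by rewrite addn0 subrr normr0 expr0 subrr mulr0 mul0r.
  rewrite addnS big_ord_recr /= addrAC.
  have -> : rho ^+ N * (1 - rho ^+ k.+1) / (1 - rho) =
      rho ^+ N * (1 - rho ^+ k) / (1 - rho) + rho ^+ (N + k).
    by rewrite exprD exprS; field.
  rewrite rmorphD (le_trans (ler_normD _ _)) // lerD // normrM normrX normr_complex_real.
  rewrite rmorphXn -[leRHS]mul1r ler_pM ?exprn_ge0 ?normr_ge0 //.
    by rewrite ler0c.
    by rewrite -(rmorph1 (real_complex R)) lecR.
  by rewrite lerXn2r // nnegrE ?normr_ge0 // (le_trans _ zrho).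
have [s s0 sE] := normr_complexP (\sum_(i < N) (a i)%:C * z ^+ i).
rewrite sE lecR; apply/ler_addgt0Pr => e e0.
have [n0 /(_ (N + n0)%N (leq_addl _ _))] := az e e0.
rewrite sub0r normrN => Sn.
rewrite -lecR -sE rmorphD -[X in `|X|](subKr (\sum_(i < N + n0) (a i)%:C * z ^+ i)).
rewrite (le_trans (ler_normB _ _)) // addrC lerD //; last exact: ltW.
apply: le_trans (tail n0) _.
rewrite lecR ler_pM2r ?invr_gt0 ?subr_gt0 // ler_piMr ?exprn_ge0 //.
by rewrite gerBl exprn_ge0.
Qed.

Lemma normr_subX_le (z z' : R[i]) (h : R) n : `|z| <= 1 -> `|z'| <= 1 ->
  `|z - z'| <= h%:C -> `|z ^+ n - z' ^+ n| <= (n%:R * h)%:C.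
Proof.
move=> z1 z'1 zz'; elim: n => [|n IH]; first by rewrite !expr0 subrr normr0 mul0r.
have -> : z ^+ n.+1 - z' ^+ n.+1 = z * (z ^+ n - z' ^+ n) + (z - z') * z' ^+ n.
  by rewrite !exprS; ring.
rewrite -natr1 [in leRHS]mulrDl mul1r rmorphD (le_trans (ler_normD _ _)) // lerD // normrM.
  by rewrite -[leRHS]mul1r ler_pM.
by rewrite -[leRHS]mulr1 normrX ler_pM ?exprn_ge0 // exprn_ile1.
Qed.

Lemma partial_sum_dist (a b : nat -> R) (z z' : R[i]) (h : R) N :
  `|z| <= 1 -> `|z'| <= 1 -> `|z - z'| <= h%:C ->
  (forall n, `|b n| <= 1) -> (forall n, (n < N)%N -> `|a n - b n| <= h) ->
  `|\sum_(i < N) (a i)%:C * z ^+ i - \sum_(i < N) (b i)%:C * z' ^+ i|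
    <= (N%:R * (1 + N%:R) * h)%:C.
Proof.
move=> z1 z'1 zz' b1 ab.
have h0 : 0 <= h by rewrite -ler0c (le_trans _ zz').
rewrite -sumrB (le_trans (ler_norm_sum _ _ _)) //.
apply: (@le_trans _ _ (\sum_(i < N) ((1 + N%:R) * h)%:C)); last first.
  by rewrite -rmorph_sum lecR sumr_const card_ord -[leLHS]mulr_natl mulrA.
apply: ler_sum => i _.
have -> : (a i)%:C * z ^+ i - (b i)%:C * z' ^+ i =
    (a i - b i)%:C * z ^+ i + (b i)%:C * (z ^+ i - z' ^+ i) by rewrite rmorphB; ring.
rewrite [in leRHS]mulrDl mul1r [leRHS]rmorphD (le_trans (ler_normD _ _)) // lerD //
  normrM normr_complex_real.
  rewrite -[leRHS]mulr1 ler_pM //.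
  - by rewrite ler0c.
  - by rewrite lecR ab.
  - by rewrite normrX exprn_ile1.
apply: (@le_trans _ _ (i%:R * h)%:C).
  rewrite -[leRHS]mul1r ler_pM ?normr_subX_le //; first by rewrite ler0c.
  by rewrite -(rmorph1 (real_complex R)) lecR.
by rewrite lecR ler_wpM2r // ler_nat ltnW.
Qed.

(** Near a point outside the closed disk the region consists of inverses of zeros [z']. A cluster
    point of their coefficient sequences gives a series whose partial sums at [z] inherit the
    uniform geometric bound. *)
Lemma limit_region_closed : closure (limit_region R) `<=` limit_region R.
Proof.
move=> w /closure_complexP clw; have [->|w0] := eqVneq w 0.
  by left; rewrite closure_unit_diskE /= normr0 ler01.
rewrite -(invrK w); apply: limit_region_inv => z1.
set z := w^-1 in z1 *.
have [r /andP[r0 r1] zr] := unit_disk_real z1.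
have wr : `|w| = r^-1%:C by rewrite -[w]invrK normfV -/z zr fmorphV.
have rp : 0 < r by rewrite -ltcR -zr normr_gt0 invr_neq0.
(* Any radius strictly between [r] and 1 would do: it bounds all nearby zeros away from the unit
   circle. *)
pose rho := (1 + r) / 2.
have rho01 : 0 <= rho < 1 by rewrite /rho; apply/andP; split; lra.
pose A e : set (nat -> R) := [set a | [/\ a 0%N = 1, forall n, `|a n| <= 1 &
  exists z', [/\ `|z'| <= rho%:C, `|z - z'| <= e%:C &
   (fun n => \sum_(i < n) (a i)%:C * z' ^+ i : R[i]^o) @ \oo --> (0 : R[i]^o)]]].
have [e e0|e e' ee' a [a0 a1 [z' [z'rho zz' az']]]|e a []//|a [a0 a1 aA]] := @sequence_cluster A.
- have rho0 : 0 < rho by rewrite /rho; lra.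
  (* The second bound forces [|y| >= 1/rho > 1], so [y] comes from a zero of modulus at most
     [rho]. *)
  pose d := Num.min e (r^-1 - rho^-1).
  have d0 : 0 < d.
    by rewrite /d lt_min e0 subr_gt0 ltf_pV2 ?posrE // /rho; lra.
  have [y yT wy] := clw d d0.
  have [s s0 sE] := normr_complexP y.
  have srho : rho^-1 <= s.
    have : r^-1%:C <= d%:C + s%:C.
      by rewrite -wr -sE -(subrK y w) (le_trans (ler_normD _ _)) // lerD2r ltW.
    rewrite -rmorphD lecR => H; have : d <= r^-1 - rho^-1 by rewrite ge_min lexx orbT.
    by lra.
  have rho1 : 1 < rho^-1 by rewrite invf_gt1 //; case/andP: rho01.
  have s1 : 1 < s by exact: lt_le_trans srho.
  have y0 : y != 0 by rewrite -normr_eq0 sE fmorph_eq0 gt_eqF // (lt_trans ltr01).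
  case: yT => [|[z' [z'1 [a [a0 a1] az']] zy]].
    by rewrite closure_unit_diskE /= sE -(rmorph1 (real_complex R)) lecR leNgt s1.
  have z'E : z' = y^-1 by rewrite -zy invrK.
  exists a; split=> //.
    move=> [|n]; first by rewrite a0 normr1.
    by have := a1 n.+1 isT; rewrite /= in_itv /= -ler_norml.
  exists z'; split.
  + rewrite z'E normfV sE -fmorphV lecR -[rho]invrK.
    by rewrite lef_pV2 ?posrE ?invr_gt0 // (lt_trans ltr01).
  + have -> : z - z' = (y - w) * (w^-1 * y^-1).
      by rewrite z'E /z; field; rewrite w0 y0.
    rewrite normrM distrC normrM !normfV wr sE -!fmorphV invrK.
    apply: (@le_trans _ _ (d%:C * 1)); last first.
      by rewrite mulr1 lecR ge_min lexx.
    rewrite -rmorphM; apply: ler_pM => //; rewrite ?(ltW wy) //.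
      by rewrite ler0c divr_ge0.
    rewrite -(rmorph1 (real_complex R)) lecR ler_pdivrMr ?(lt_trans ltr01) //.
    by rewrite mul1r ltW // (lt_trans r1).
  + move: az'; rewrite (_ : series _ = (fun n => \sum_(i < n) (a i)%:C * z' ^+ i)) //.
    by apply/funext => n; rewrite /series /= big_mkord.
- by split=> //; exists z'; split=> //; apply: le_trans zz' _; rewrite lecR.
apply: (G_of_partial_sums z1 a0 a1); apply: (@cvg0_geometric _ _ (rho / (1 - rho)) rho rho01) => n.
have [s s0 sE] := normr_complexP (\sum_(i < n.+1) (a i)%:C * z ^+ i).
rewrite sE lecR; apply/ler_addgt0Pr => e e0.
(* Chosen so that the bound of [partial_sum_dist] for [n.+1] terms is exactly [e]. *)
pose h := e / (n.+1%:R * (1 + n.+1%:R)).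
have h0 : 0 < h by rewrite divr_gt0 // mulr_gt0 // addr_gt0.
have [b [b0 b1 [z' [z'rho zz' bz']]] ab] := aA h h n.+1 h0 h0.
have z'1 : `|z'| <= 1.
  by rewrite (le_trans z'rho) // -(rmorph1 (real_complex R)) lecR; case/andP: rho01 => _ /ltW.
have := zero_partial_sum n.+1 rho01 z'rho b1 bz'.
have := partial_sum_dist (ltW z1) z'1 zz' b1 (fun n nN => ltW (ab n nN)).
rewrite /h mulrC divfK; last by rewrite gt_eqF // mulr_gt0 // addr_gt0.
move=> H1 H2; rewrite -lecR -sE.
rewrite -[X in `|X|](subrK (\sum_(i < n.+1) (b i)%:C * z' ^+ i)) (le_trans (ler_normD _ _)) //.
by rewrite addrC rmorphD lerD // mulrAC -exprS.
Qed.

End Closedness.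

(** * Density *)

Section Density.
Variable R : realType.

(** If [z] is not real, 1 and [z] form a real basis of the plane; if [z] is real, only real [t] are
    concerned and [y = 0] works. This lets a small complex error be absorbed by two real
    coefficients. *)
Lemma real_span (z : R[i]) : exists2 C : R, 0 < C &
  forall t : R[i], (z \is Num.real -> t \is Num.real) ->
    exists x y : R, [/\ t = x%:C + y%:C * z, `|x|%:C <= C%:C * `|t| &
      `|y|%:C <= C%:C * `|t|].
Proof.
case: z => p q; have [q0|q0] := eqVneq q 0.
  exists 1 => [|t]; first exact: ltr01.
  rewrite q0 complex_real eqxx => /(_ isT)/complex_realP[x ->].
  exists x, 0; rewrite !rmorph0 mul0r addr0 rmorph1 mul1r normr_complex_real lexx.
  by rewrite normr0; split=> //; rewrite ler0c.
have nq0 : 0 < `|q| by rewrite normr_gt0.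
exists (1 + (1 + `|p|) / `|q|) => [|t _].
  by rewrite addr_gt0 // divr_gt0 // (lt_le_trans ltr01) // lerDl.
have [s s0 sE] := normr_complexP t; rewrite sE -!rmorphM.
have [tu tv] : `|complex.Re t| <= s /\ `|complex.Im t| <= s.
  split; rewrite -lecR -sE; first exact: normc_ge_Re.
  have := normc_ge_Re (t * 'i%C); rewrite ReiNIm normrN normrM.
  by rewrite [`|'i%C|]normc_def /= expr0n expr1n /= add0r sqrtr1 mulr1.
case: t sE tu tv => u v _ /= us vs.
exists (u - v * p / q), (v / q); split.
- apply/eqP; rewrite eq_complex /= !mul0r subr0 !addr0 add0r.
  by apply/andP; split; apply/eqP; field.
- rewrite lecR (le_trans (ler_normB _ _)) // !normrM normfV mulrDl mul1r lerD //.
  rewrite [leRHS]mulrAC ler_pM2r ?invr_gt0 // mulrC.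
  by rewrite ler_pM // lerDr.
- rewrite lecR normrM normfV mulrDl mul1r -[leLHS]add0r lerD // mulrAC ler_pM2r ?invr_gt0 //.
  by rewrite (le_trans vs) // ler_peMl // lerDl.
Qed.

Lemma unit_coef_root_poly (p : {poly R}) (w : R[i]) : p \is monic ->
  (forall i, `|p`_i| <= 1) -> root (map_poly (real_complex R) p) w ->
  unit_coef_root R w.
Proof.
move=> pmon p1 pw; pose N := (size p).-1.
exists (fun n => if (n <= N)%N then p`_(N - n) else 0), N; split.
- by rewrite subn0 -/(lead_coef p) (monicP pmon).
- by move=> n; case: ifP; rewrite ?normr0.
rewrite (_ : revpoly _ N = p) //; apply/polyP => i; rewrite coef_revpoly leq_subr.
case: leqP => iN; first by rewrite subKn.
by rewrite nth_default // -(prednK (n := size p)) // size_poly_gt0 monic_neq0.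
Qed.

(** For large [N] the power [w^N] is small, hence [w^N = x + y w] with real [|x|, |y| <= 1], and [w]
    is a root of [X^N - y X - x]. *)
Lemma unit_disk_sub_unit_coef_root : unit_disk R `<=` unit_coef_root R.
Proof.
move=> w w1; have [C C0 spanC] := real_span w.
have [r /andP[r0 r1] wr] := unit_disk_real w1.
have [N N2 CN] : exists2 N, (2 <= N)%N & C * r ^+ N <= 1.
  have : (fun n => C * r ^+ n) @ \oo --> (0 : R).
    rewrite -[X in _ --> X](mulr0 C); apply: cvgMr; apply: cvg_expr.
    by rewrite ger0_norm.
  move/cvgrPdist_lt => /(_ 1 ltr01)[n0 _ Hn0].
  exists (maxn n0 2); first exact: leq_maxr.
  have := Hn0 (maxn n0 2) (leq_maxl _ _); rewrite sub0r normrN.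
  by move=> /ltW; apply: le_trans; exact: ler_norm.
have [|x [y [wN xle yle]]] := spanC (w ^+ N); first exact: rpredX.
have norm_le1 (u : R) : `|u|%:C <= C%:C * `|w ^+ N| -> `|u| <= 1.
  by rewrite normrX wr -rmorphXn -rmorphM lecR => /le_trans; apply.
have x1 := norm_le1 _ xle; have y1 := norm_le1 _ yle.
have sz : (size (y *: 'X + x%:P)%R < N.+1)%N.
  rewrite ltnS (leq_trans _ N2) // (leq_trans (size_polyD _ _)) // geq_max.
  rewrite (leq_trans (size_scale_leq _ _)) ?size_polyX //.
  by rewrite (leq_trans (size_polyC_leq1 _)).
apply: (@unit_coef_root_poly ('X^N - (y *: 'X + x%:P))).
- rewrite monicE lead_coefDl ?lead_coefXn // size_polyN size_polyXn //.
- move=> i; rewrite coefB coefD coefZ coefXn coefX coefC.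
  case: eqP => [->|_]; last first.
    case: i => [|[|i]] /=; rewrite ?mulr0 ?mulr1 ?addr0 ?add0r ?sub0r ?normrN ?normr0 //.
  rewrite (gtn_eqF N2) gtn_eqF; last exact: ltnW.
  by rewrite mulr0 addr0 subr0 normr1.
rewrite rootE rmorphB rmorphD /= map_polyXn map_polyZ /= map_polyX map_polyC /=.
by rewrite !hornerE wN /=; apply/eqP; ring.
Qed.

Lemma G_inv_sub_closure :
  invset (G_ `[(-1 : R), 1]) `<=` closure (unit_coef_root R).
Proof.
move=> _ [z [z1 [a [a0 aI] az]] <-].
have [->|z0] := eqVneq z 0.
  by apply/subset_closure/unit_disk_sub_unit_coef_root; rewrite /unit_disk /= invr0 normr0.
have a1 n : `|a n| <= 1.
  case: n => [|n]; first by rewrite a0 normr1.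
  by have := aI n.+1 isT; rewrite /= in_itv /= -ler_norml.
(* Replacing [w] by [t w] with [t < 1] multiplies [a n] by [t^n]; the slack gained
   absorbs the truncation error in the coefficients of degree 1 and 2. *)
set w := z^-1; have [r r0 wr] := normr_complexP w.
apply/closure_complexP => e e0.
pose d := e / (1 + r).
have r1 : 0 < 1 + r by rewrite ltr_pwDl.
have d0 : 0 < d by rewrite divr_gt0.
(* Then [1 - t = d t], so [w] moves by at most [d r < e]. *)
pose t := (1 + d)^-1.
have d1 : 0 < 1 + d by rewrite addr_gt0.
have t0 : 0 < t by rewrite invr_gt0.
have t1 : t < 1 by rewrite invf_lt1 // ltrDl.
have tC0 : t%:C != 0 :> R[i] by rewrite fmorph_eq0 gt_eqF.
have wt : `|w - t%:C * w| < e%:C.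
  rewrite -[X in X - _]mul1r -mulrBl normrM -(rmorph1 (real_complex R)) -rmorphB.
  rewrite normr_complex_real wr -rmorphM ltcR gtr0_norm ?subr_gt0 //.
  have -> : 1 - t = d * t by rewrite /t; field; rewrite gt_eqF.
  apply: (@le_lt_trans _ _ (d * r)); first by rewrite ler_wpM2r // ler_piMr // ltW.
  by rewrite /d mulrAC ltr_pdivrMr // ltr_pM2l // ltrDr.
exists (t%:C * w) => //.
set v := t%:C * w.
have v0 : v != 0 by rewrite mulf_neq0 // invr_neq0.
pose b n := a n * t ^+ n.
have bS n : \sum_(i < n) (b i)%:C * v^-1 ^+ i = \sum_(i < n) (a i)%:C * z ^+ i.
  apply: eq_bigr => i _; rewrite /b rmorphM rmorphXn /v /w invfM invrK exprMn exprVn.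
  by rewrite -mulrA; congr (_ * _); rewrite mulVKf // expf_neq0.
have [C C0 spanC] := real_span v^-1.
have [s s0 sE] := normr_complexP v.
(* A partial sum below [h] needs corrections of size at most [1 - t], the slack left by [|b n| <= t]
   for [n >= 1]. *)
pose h := (1 - t) / (C * (1 + s)).
have h0 : 0 < h by rewrite divr_gt0 ?subr_gt0 // mulr_gt0 // ltr_pwDl.
have /cvg_complexP/(_ h h0)[n0 Hn0] :
    (fun n => \sum_(i < n) (a i)%:C * z ^+ i : R[i]^o) @ \oo --> (0 : R[i]^o).
  move: az; rewrite (_ : series _ = (fun n => \sum_(i < n) (a i)%:C * z ^+ i)) //.
  by apply/funext => n; rewrite /series /= big_mkord.
have := Hn0 n0.+3 (leq_trans (leqnSn _) (leqW (leqnSn _))).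
rewrite sub0r normrN -bS; set S := \sum_(i < _) _ => Sh.
(* Decomposing [v S] instead of [S] gives [S = x v^-1 + y v^-2], so the leading coefficient 1 is
   left untouched. *)
have [|x [y [Sxy xle yle]]] := spanC (v * S).
  rewrite realV => vreal; rewrite rpredM // rpred_sum // => i _.
  by rewrite rpredM ?rpredX ?rpredV // complex_real.
have norm_le (u : R) : `|u|%:C <= C%:C * `|v * S| -> `|u| <= 1 - t.
  have [m m0 mE] := normr_complexP S.
  rewrite normrM sE mE -!rmorphM lecR => /le_trans; apply.
  move: Sh; rewrite mE ltcR /h ltr_pdivlMr; last by rewrite mulr_gt0 // ltr_pwDl.
  by move=> /ltW; apply: le_trans; rewrite [leRHS]mulrCA ler_pM2l //  mulrC ler_wpM2l // lerDr.
have x1 := norm_le _ xle; have y1 := norm_le _ yle.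
pose b' n := b n - x * (n == 1%N)%:R - y * (n == 2)%:R.
have bt n : `|b n.+1| <= t.
  rewrite /b normrM normrX (gtr0_norm t0) exprS mulrCA ler_piMr ?(ltW t0) //.
  by rewrite mulr_ile1 ?exprn_ge0 ?exprn_ile1 ?(ltW t0) ?(ltW t1).
exists b', n0.+2; split.
- by rewrite /b' /b /= a0 expr0 !mulr0 !subr0 mulr1.
- case=> [|[|[|n]]]; rewrite /b' /= ?mulr1 ?mulr0 ?subr0.
  + by rewrite /b a0 expr0 mulr1 normr1.
  + by rewrite (le_trans (ler_normB _ _)) //; have := bt 0%N; lra.
  + by rewrite (le_trans (ler_normB _ _)) //; have := bt 1%N; lra.
  + by rewrite (le_trans (bt _)) // ltW.
rewrite rootE map_revpoly horner_revpolyV // mulf_eq0; apply/orP; right; apply/eqP.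
have -> : \sum_(i < n0.+3) (real_complex R \o b') i * v^-1 ^+ i =
    S - x%:C * v^-1 - y%:C * v^-1 ^+ 2.
  rewrite /S !big_ord_recl /= /b' /bump /=.
  under eq_bigr => i _ do rewrite !mulr0 !subr0.
  rewrite !mulr0 !mulr1 !subr0 !rmorphB /=; ring.
have -> : S = v^-1 * (v * S) by rewrite mulKf.
by rewrite Sxy; ring.
Qed.

Lemma limit_region_sub_closure : limit_region R `<=` closure (unit_coef_root R).
Proof.
move=> w [|]; last exact: G_inv_sub_closure.
by apply: closure_subset; exact: unit_disk_sub_unit_coef_root.
Qed.

Lemma unit_coef_root_sub_Phi : unit_coef_root R `<=` Phi R E_alt.
Proof.
move=> w wroot; apply/closure_complexP => e e0.
have [b [N [v [bb bN vconj _ wv]]]] := unit_coef_root_near e0 wroot.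
exists v => //; exists b; split=> //.
by case: bN => N1 NEP _; exists N.
Qed.

Lemma unit_coef_root_sub_Phi_star : unit_coef_root R `<=` Phi_star R E_alt.
Proof.
move=> w wroot; apply/closure_complexP => e e0.
have [b [N [v [bb bN vconj vroot wv]]]] := unit_coef_root_near e0 wroot.
have b1 : 1 < b by case: bb.
(* The constant term of the cofactor is [+/- tau^N(1)], a nonzero element of [EP]; so [v^-1] is a
   genuine inverse. *)
have v0 : v != 0.
  apply: contraTneq vroot => ->; rewrite rootE map_revpoly horner_coef0 coef_revpoly /= subn0.
  rewrite fmorph_eq0 /orbit_coef mulf_neq0 //.
    by rewrite -normr_gt0 normr_ssign ltr01.
  case: bN => _ [k /andP[k0 _] <-] _.
  by rewrite mulf_neq0 ?invr_neq0 ?pnatr_eq0 -?lt0n // gt_eqF // (lt_trans ltr01).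
exists v => //; exists b, v^-1, (\sum_(n < N) phi_term b E_alt v^-1 n +
       (b * iter N (tau b E_alt) 1 * ssign b E_alt 1 N)%:C * v^-1 ^+ N.+1); split=> //.
- exact: PhiSimple.
- rewrite phi_simple_factor; move: vroot.
  rewrite rootE map_revpoly horner_revpolyV // mulf_eq0 expf_eq0 (negPf v0) andbF /=.
  by move=> /eqP ->; rewrite mulr0.
- case: vconj => vb _; apply: contra vb => /eqP vE.
  by rewrite -[v]invrK vE -fmorphV invrK.
- by rewrite invrK.
Qed.

End Density.

Theorem theorem2p5 (R : realType) :
  [/\ Phi R E_alt = Phi_hat R E_alt,
      Phi_hat R E_alt = Phi_star R E_alt &
      Phi_star R E_alt =
        closure (unit_disk R) `|` invset (G_ `[(-1 : R), 1])].
Proof.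
(* Each of the three closures is squeezed between two copies of [limit_region]. *)
have Phi_hatE : Phi R E_alt `<=` Phi_hat R E_alt.
  apply: closure_subset => w [b [bb bs bw]]; exists b; split=> //.
  by case: bb => b1 _; exact: simple_gen_parry.
have hat_sub : Phi_hat R E_alt `<=` limit_region R.
  apply: subset_trans (@limit_region_closed R); apply: closure_subset.
  by move=> w [b [bb bs bw]]; exact: galois_conjugate_limit_region bb bs bw.
have star_sub : Phi_star R E_alt `<=` limit_region R.
  apply: subset_trans (@limit_region_closed R); apply: closure_subset.
  by move=> _ [b [z [v [bb phiz v1 zb ->]]]]; exact: phi_at_limit_region bb phiz v1 zb.
have sub_Phi : limit_region R `<=` Phi R E_alt.
  apply: subset_trans (@limit_region_sub_closure R) _; rewrite -[Phi _ _]closure_closure.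
  by apply: closure_subset; exact: unit_coef_root_sub_Phi.
have sub_star : limit_region R `<=` Phi_star R E_alt.
  apply: subset_trans (@limit_region_sub_closure R) _; rewrite -[Phi_star _ _]closure_closure.
  by apply: closure_subset; exact: unit_coef_root_sub_Phi_star.
have PhiE : Phi R E_alt = limit_region R.
  by apply/seteqP; split=> //; exact: subset_trans Phi_hatE hat_sub.
have hatE : Phi_hat R E_alt = limit_region R.
  by apply/seteqP; split=> //; exact: subset_trans sub_Phi Phi_hatE.
have starE : Phi_star R E_alt = limit_region R by apply/seteqP.
by rewrite PhiE hatE starE.
Qed.
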